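(* Let $I=[a,b]\subset\mathbb{R}$, let $\varphi:I\to I$, and let $f:I\to(0,\infty)$ be a $\varphi$-quasi-convex function. Let $t_1,\dots,t_n\in(0,1)$ with $\sum_{i=1}^n t_i=1$, and let $x_1,\dots,x_n\in I$. Then $$f\left(\sum_{i=1}^n t_i\varphi(x_i)\right)\le\max_{1\le i\le n}f(\varphi(x_i)).$$
   Context: A function $f:I\to(0,\infty)$ is $\varphi$-quasi-convex if $f(t\varphi(x)+(1-t)\varphi(y))\le\max\{f(\varphi(x)),f(\varphi(y))\}$ for all $x,y\in I$ and $t\in[0,1]$. *)

(* Defs.v *)
From mathcomp Require Import all_boot all_order all_algebra.
From mathcomp Require Import reals.

Set Implicit Arguments.
Unset Strict Implicit.
Unset Printing Implicit Defensive.

Import Order.TTheory GRing.Theory Num.Theory.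

Local Open Scope ring_scope.

(* Functions on I are total functions on R of which only the values on I are
   constrained; that phi maps I to I and that f is positive on I are stated
   separately, not bundled here. *)
Definition phi_quasi_convex (R : realType) (I : interval R) (phi f : R -> R) :
    Prop :=
  forall x y t : R, x \in I -> y \in I -> t \in `[0, 1] ->
    f (t * phi x + (1 - t) * phi y) <= Num.max (f (phi x)) (f (phi y)).

(* Main.v *)
(* On the line, a convex combination of the points phi (x i) lies between the
   smallest and the largest of them, hence is a convex combination of these two
   alone, and a single use of quasi-convexity suffices.  The usual induction on
   n would not work: partial combinations need not be in the image of phi. *)

Require Import Defs.
From mathcomp Require Import all_boot all_order all_algebra.
From mathcomp Require Import reals ring.

Set Implicit Arguments.
Unset Strict Implicit.
Unset Printing Implicit Defensive.

Import Order.TTheory GRing.Theory Num.Theory.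

Local Open Scope ring_scope.

Lemma segment_convex_combination (R : realFieldType) (u v s : R) :
  u <= s <= v -> exists2 c, c \in `[0, 1] & s = c * u + (1 - c) * v.
Proof.
move=> /andP[us sv]; have [uv|vu] := ltP u v; last first.
  (* Here [v <= u] forces [u = s = v], so any weight would do. *)
  exists 0; first by rewrite in_itv /= lexx ler01.
  rewrite mul0r add0r subr0 mul1r; apply/eqP.
  by rewrite eq_le sv (le_trans vu us).
have vu0 : 0 < v - u by rewrite subr_gt0.
(* Solution of [s = c * u + (1 - c) * v] for [c]. *)
exists ((v - s) / (v - u)).
  rewrite in_itv /= divr_ge0 ?(ltW vu0) ?subr_ge0 //=.
  by rewrite ler_pdivrMr // mul1r lerD2l lerN2.
by field; rewrite gt_eqF.
Qed.

(** As the weights sum to 1, [u] and [v] are weighted sums of constants, and the sums compare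
    termwise. *)
Lemma convex_combination_bounds (R : realDomainType) (I : finType)
    (t p : I -> R) (u v : R) :
  (forall i, 0 <= t i) -> \sum_i t i = 1 -> (forall i, u <= p i <= v) ->
  u <= \sum_i t i * p i <= v.
Proof.
move=> t_ge0 sumt uv; rewrite -[u]mul1r -[v]mul1r -sumt !mulr_suml.
by apply/andP; split; apply: ler_sum => i _; apply: ler_wpM2l => //;
  have /andP[] := uv i.
Qed.

(* The default value 0 of the iterated maximum is harmless: the sum condition
   forces n > 0, and all the values f (phi (x i)) are positive. *)
Theorem theorem11 (R : realType) (a b : R) (phi f : R -> R)
  (phiI : forall x, x \in `[a, b] -> phi x \in `[a, b])
  (f_gt0 : forall x, x \in `[a, b] -> 0 < f x)
  (fqc : phi_quasi_convex `[a, b] phi f)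
  (n : nat) (t x : 'I_n -> R)
  (t01 : forall i, t i \in `]0, 1[)
  (sumt : \sum_(i < n) t i = 1)
  (xI : forall i, x i \in `[a, b]) :
  f (\sum_(i < n) t i * phi (x i)) <= \big[Num.max/0]_(i < n) f (phi (x i)).
Proof.
case: n t x t01 sumt xI => [|n] t x t01 sumt xI.
  by move/eqP: sumt; rewrite big_ord0 eq_sym oner_eq0.
pose p i := phi (x i).
(* The extremes are attained at indices [i] and [j], so both endpoints are values of [phi] at points
   of [[a, b]], as [fqc] requires. *)
have [i _ pi_min] := @arg_minP _ _ _ ord0 xpredT p isT.
have [j _ pj_max] := @arg_maxP _ _ _ ord0 xpredT p isT.
have [|c c01 ->] := @segment_convex_combination R (p i) (p j)
    (\sum_k t k * p k).
  apply: convex_combination_bounds => // k; last first.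
    by apply/andP; split; [exact: pi_min | exact: pj_max].
  by have := t01 k; rewrite in_itv /= => /andP[/ltW].
apply: le_trans (fqc _ _ _ (xI i) (xI j) c01) _.
by rewrite ge_max !(le_bigmax _ (fun k => f (phi (x k)))).
Qed.
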